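(* Let $k,\rho,c,\ell,\gamma,D_\infty>0$ and $0<\varepsilon<1$ be real constants and let $\alpha=\frac{k}{\rho c}$. For each $h_0>\frac{1}{D_\infty}\sqrt{\frac{\gamma(1-\varepsilon)\rho\ell k}{2}}$ let $T(x,t,h_0)$, $s(t,h_0)$, $r(t,h_0)$ be the solution of Problem $(P_1)$ with heat transfer coefficient $h_0$, and let $T_\infty(x,t)$, $s_\infty(t)$, $r_\infty(t)$ be the solution of the phase-change process with mushy region and temperature condition $T(0,t)=-D_\infty$ at the fixed face (both described, with their explicit formulas, in the context). Then, for every $t>0$ and $0<x<s_\infty(t)$, $$\lim_{h_0\to\infty}T(x,t,h_0)=T_\infty(x,t),\qquad \lim_{h_0\to\infty}s(t,h_0)=s_\infty(t),\qquad \lim_{h_0\to\infty}r(t,h_0)=r_\infty(t).$$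
   Context: $\operatorname{erf}(x)=\frac{2}{\sqrt{\pi}}\int_0^x e^{-u^2}\,du$. Common conditions for a triple $(T,s,r)$ with $s(t)<r(t)$ for $t>0$: (i) $T_t-\alpha T_{xx}=0$ for $0<x<s(t)$, $t>0$; (ii) $T(s(t),t)=0$, $t>0$; (iii) $kT_x(s(t),t)=\rho\ell[\varepsilon\dot s(t)+(1-\varepsilon)\dot r(t)]$, $t>0$; (iv) $T_x(s(t),t)(r(t)-s(t))=\gamma$, $t>0$; (v) $s(0)=r(0)=0$. Problem $(P_1)$: (i)–(v) together with $kT_x(0,t)=\frac{h_0}{\sqrt t}(T(0,t)+D_\infty)$, $t>0$. For $h_0>\frac{1}{D_\infty}\sqrt{\frac{\gamma(1-\varepsilon)\rho\ell k}{2}}$, its solution is $$T(x,t,h_0)=-\frac{\frac{h_0D_\infty\sqrt{\pi\alpha}}{k}\operatorname{erf}(\xi)}{1+\frac{h_0\sqrt{\pi\alpha}}{k}\operatorname{erf}(\xi)}\left[1-\frac{\operatorname{erf}\left(\frac{x}{2\sqrt{\alpha t}}\right)}{\operatorname{erf}(\xi)}\right]\ (0<x<s(t,h_0)),\quad s(t,h_0)=2\xi\sqrt{\alpha t},\quad r(t,h_0)=2\mu\sqrt{\alpha t},$$ $$\mu=\xi+\frac{\gamma k}{2D_\infty h_0\sqrt{\alpha}}e^{\xi^2}\left[1+\frac{h_0\sqrt{\pi\alpha}}{k}\operatorname{erf}(\xi)\right],$$ where $\xi=\xi(h_0)>0$ is the unique positive solution of $\frac{D_\infty c}{\ell\sqrt{\pi}}F(x)=G(x)$,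 with $F(x)=\frac{e^{-x^2}}{\frac{k}{h_0\sqrt{\pi\alpha}}+\operatorname{erf}(x)}$ and $G(x)=x+\frac{\gamma(1-\varepsilon)\sqrt{\pi}}{2D_\infty}\frac{1}{F(x)}$. Limit problem: (i)–(v) together with $T(0,t)=-D_\infty$, $t>0$. Its (known) solution is $$T_\infty(x,t)=-D_\infty\left[1-\frac{\operatorname{erf}\left(\frac{x}{2\sqrt{\alpha t}}\right)}{\operatorname{erf}(\xi_\infty)}\right]\ (0<x<s_\infty(t)),\quad s_\infty(t)=2\xi_\infty\sqrt{\alpha t},\quad r_\infty(t)=2\mu_\infty\sqrt{\alpha t},$$ $$\mu_\infty=\xi_\infty+\frac{\gamma\sqrt{\pi}}{2D_\infty}e^{\xi_\infty^2}\operatorname{erf}(\xi_\infty),$$ where $\xi_\infty>0$ is the unique positive solution of $$\frac{1}{F_\infty(x)}\left[x+\frac{\gamma(1-\varepsilon)\sqrt{\pi}}{2D_\infty}\frac{1}{F_\infty(x)}\right]=\frac{D_\infty c}{\ell\sqrt{\pi}},\qquad F_\infty(x)=\frac{e^{-x^2}}{\operatorname{erf}(x)}.$$ For fixed $(x,t)$ with $0<x<s_\infty(t)$, the limit of $T(x,t,h_0)$ is taken over $h_0$ large enough that $x<s(t,h_0)$. *)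

(* Defs.v *)
From Stdlib Require Import Reals.
From Coquelicot Require Import Coquelicot.
Open Scope R_scope.

Definition erf (x : R) : R :=
  2 / sqrt PI * RInt (fun u => exp (- u ^ 2)) 0 x.

Record constants : Type := {
  k : R; rho : R; c : R; ell : R; gamma : R; Dinf : R; eps : R;
  k_gt0 : 0 < k; rho_gt0 : 0 < rho; c_gt0 : 0 < c; ell_gt0 : 0 < ell;
  gamma_gt0 : 0 < gamma; Dinf_gt0 : 0 < Dinf;
  eps_gt0 : 0 < eps; eps_lt1 : eps < 1 }.

Definition alpha (p : constants) : R := k p / (rho p * c p).

(* The temperature only has a meaning on 0 <= x <= s(t), so its space
   derivatives on the fixed face and on the front are one-sided. *)
Definition is_right_derive (f : R -> R) (a l : R) : Prop :=
  filterlim (fun y => (f y - f a) / (y - a)) (at_right a) (locally l).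

Definition is_left_derive (f : R -> R) (a l : R) : Prop :=
  filterlim (fun y => (f y - f a) / (y - a)) (at_left a) (locally l).

(* Conditions common to both problems, for T : x -> t -> temperature.  The
   second one only expresses that T(0,t) is the boundary value of T(.,t) at the
   fixed face; at the front this is contained in the one-sided derivative. *)
Definition mushy_conditions (p : constants)
    (T : R -> R -> R) (s r : R -> R) : Prop :=
  (forall t, 0 < t -> 0 < s t < r t) /\
  (forall t, 0 < t ->
     filterlim (fun x => T x t) (at_right 0) (locally (T 0 t))) /\
  (forall x t, 0 < t -> 0 < x < s t ->
     ex_derive (fun y => T y t) x /\
     exists Tt Txx,
       is_derive (fun tau => T x tau) t Tt /\
       is_derive_n (fun y => T y t) 2 x Txx /\
       Tt - alpha p * Txx = 0) /\
  (forall t, 0 < t -> T (s t) t = 0) /\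
  (forall t, 0 < t -> exists Tx s' r',
     is_left_derive (fun y => T y t) (s t) Tx /\
     is_derive s t s' /\ is_derive r t r' /\
     k p * Tx = rho p * ell p * (eps p * s' + (1 - eps p) * r') /\
     Tx * (r t - s t) = gamma p) /\
  s 0 = 0 /\ r 0 = 0.

(* Convective condition of heat transfer coefficient h0 on the fixed face. *)
Definition problem_P1 (p : constants) (h0 : R)
    (T : R -> R -> R) (s r : R -> R) : Prop :=
  mushy_conditions p T s r /\
  (forall t, 0 < t -> exists Tx,
     is_right_derive (fun y => T y t) 0 Tx /\
     k p * Tx = h0 / sqrt t * (T 0 t + Dinf p)).

(* Temperature condition on the fixed face. *)
Definition limit_problem (p : constants)
    (T : R -> R -> R) (s r : R -> R) : Prop :=
  mushy_conditions p T s r /\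
  (forall t, 0 < t -> T 0 t = - Dinf p).

Definition h0_threshold (p : constants) : R :=
  1 / Dinf p * sqrt (gamma p * (1 - eps p) * rho p * ell p * k p / 2).

Definition F (p : constants) (h0 x : R) : R :=
  exp (- x ^ 2) / (k p / (h0 * sqrt (PI * alpha p)) + erf x).

Definition G (p : constants) (h0 x : R) : R :=
  x + gamma p * (1 - eps p) * sqrt PI / (2 * Dinf p) * (1 / F p h0 x).

Definition is_xi (p : constants) (h0 : R) : R -> Prop :=
  unique (fun x => 0 < x /\
    Dinf p * c p / (ell p * sqrt PI) * F p h0 x = G p h0 x).

Definition mu (p : constants) (h0 xi : R) : R :=
  xi + gamma p * k p / (2 * Dinf p * h0 * sqrt (alpha p)) * exp (xi ^ 2)
       * (1 + h0 * sqrt (PI * alpha p) / k p * erf xi).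

Definition T_formula (p : constants) (h0 xi x t : R) : R :=
  - ((h0 * Dinf p * sqrt (PI * alpha p) / k p * erf xi)
     / (1 + h0 * sqrt (PI * alpha p) / k p * erf xi))
  * (1 - erf (x / (2 * sqrt (alpha p * t))) / erf xi).

(* The solution of the convective problem: the triple solving it that has the
   similarity form.  No uniqueness theorem among all classical solutions of the
   free boundary problem is presupposed. *)
Definition is_solution_P1 (p : constants) (h0 : R)
    (T : R -> R -> R) (s r : R -> R) : Prop :=
  problem_P1 p h0 T s r /\
  exists xi, is_xi p h0 xi /\
    forall t, 0 < t ->
      s t = 2 * xi * sqrt (alpha p * t) /\
      r t = 2 * mu p h0 xi * sqrt (alpha p * t) /\
      forall x, 0 < x < s t -> T x t = T_formula p h0 xi x t.

Definition Finf (x : R) : R := exp (- x ^ 2) / erf x.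

Definition is_xi_inf (p : constants) : R -> Prop :=
  unique (fun x => 0 < x /\
    1 / Finf x *
      (x + gamma p * (1 - eps p) * sqrt PI / (2 * Dinf p) * (1 / Finf x))
    = Dinf p * c p / (ell p * sqrt PI)).

Definition mu_inf (p : constants) (xi : R) : R :=
  xi + gamma p * sqrt PI / (2 * Dinf p) * exp (xi ^ 2) * erf xi.

Definition Tinf_formula (p : constants) (xi x t : R) : R :=
  - Dinf p * (1 - erf (x / (2 * sqrt (alpha p * t))) / erf xi).

Definition is_limit_solution (p : constants)
    (T : R -> R -> R) (s r : R -> R) : Prop :=
  limit_problem p T s r /\
  exists xi, is_xi_inf p xi /\
    forall t, 0 < t ->
      s t = 2 * xi * sqrt (alpha p * t) /\
      r t = 2 * mu_inf p xi * sqrt (alpha p * t) /\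
      forall x, 0 < x < s t -> T x t = Tinf_formula p xi x t.

(* Main.v *)
(** With [a = k / (h0 * sqrt (PI * alpha))], the equation for [xi] reads
    [Phi (a, xi) = K], where [Phi (a, x) = E (x + B E)], [E = (a + erf x) exp (x ^ 2)], [B, K > 0],
    and the equation for the limit coefficient is [Phi (0, xi_inf) = K].  As [Phi] is
    increasing in both variables and continuous in [a], [xi <= xi_inf], and any
    [y < xi_inf] is eventually below [xi] as [a] tends to [0].  The formulas for [T],
    [s] and [r] are continuous in [(a, xi)] up to [a = 0]. *)
Require Import Defs.
From Stdlib Require Import Reals Lra.
From Coquelicot Require Import Coquelicot.
Open Scope R_scope.

(** * The error function: derivative, continuity, monotonicity and sign *)

Lemma is_derive_erf (x : R) : is_derive erf x (2 / sqrt PI * exp (- x ^ 2)).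
Proof.
  assert (Hc : forall y, continuous (fun u => exp (- u ^ 2)) y).
  { intros y. apply (ex_derive_continuous (fun u => exp (- u ^ 2))). auto_derive; trivial. }
  unfold erf. apply (is_derive_scal (fun z => RInt (fun u => exp (- u ^ 2)) 0 z)).
  apply (is_derive_RInt (fun u => exp (- u ^ 2)) _ 0).
  - apply filter_forall. intros y. apply (RInt_correct (V := R_CompleteNormedModule)).
    apply (ex_RInt_continuous (V := R_CompleteNormedModule)). intros z _. apply Hc.
  - apply Hc.
Qed.

Lemma continuous_erf (x : R) : continuous erf x.
Proof. apply (ex_derive_continuous erf). eexists. apply is_derive_erf. Qed.

Lemma erf_incr (x y : R) : x < y -> erf x < erf y.
Proof.
  intros Hxy.
  apply (incr_function erf m_infty p_infty (fun z => 2 / sqrt PI * exp (- z ^ 2)));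
    simpl; trivial.
  - intros z _ _. apply is_derive_erf.
  - intros z _ _. apply Rmult_lt_0_compat; [|apply exp_pos].
    apply Rdiv_lt_0_compat; [lra|]. apply sqrt_lt_R0, PI_RGT_0.
Qed.

Lemma erf_0 : erf 0 = 0.
Proof. unfold erf. rewrite RInt_point. apply Rmult_0_r. Qed.

Lemma erf_gt0 (x : R) : 0 < x -> 0 < erf x.
Proof. intros Hx. rewrite <- erf_0. now apply erf_incr. Qed.

(** * The reduced equation [Phi B a x = K] and its dependence on [a] and [x] *)

Definition recipF (a x : R) : R := (a + erf x) * exp (x ^ 2).

Definition Phi (B a x : R) : R := recipF a x * (x + B * recipF a x).

Lemma recipF_gt0 (a x : R) : 0 <= a -> 0 < x -> 0 < recipF a x.
Proof.
  intros Ha Hx. pose proof (erf_gt0 x Hx).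
  apply Rmult_lt_0_compat; [lra|apply exp_pos].
Qed.

Lemma recipF_le (a b x : R) : a <= b -> recipF a x <= recipF b x.
Proof.
  intros Hab. apply Rmult_le_compat_r; [apply Rlt_le, exp_pos|lra].
Qed.

Lemma recipF_incr (a x y : R) : 0 <= a -> 0 < x -> x < y -> recipF a x < recipF a y.
Proof.
  intros Ha Hx Hxy. pose proof (erf_gt0 x Hx). pose proof (erf_incr x y Hxy).
  apply Rmult_le_0_lt_compat; [lra|apply Rlt_le, exp_pos|lra|].
  apply exp_increasing. nra.
Qed.

Lemma Phi_le (B a b x : R) :
  0 < B -> 0 <= a -> a <= b -> 0 < x -> Phi B a x <= Phi B b x.
Proof.
  intros HB Ha Hab Hx. unfold Phi.
  pose proof (recipF_gt0 a x Ha Hx). pose proof (recipF_le a b x Hab).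
  apply Rmult_le_compat; nra.
Qed.

(** For [a >= 0] both factors of [Phi] are positive and strictly increasing on the positive
    half-line. *)
Lemma Phi_incr (B a x y : R) :
  0 < B -> 0 <= a -> 0 < x -> x < y -> Phi B a x < Phi B a y.
Proof.
  intros HB Ha Hx Hxy. unfold Phi.
  pose proof (recipF_gt0 a x Ha Hx). pose proof (recipF_incr a x y Ha Hx Hxy).
  apply Rmult_le_0_lt_compat; nra.
Qed.

Lemma continuous_Phi_l (B a x : R) : continuous (fun b => Phi B b x) a.
Proof.
  apply (ex_derive_continuous (fun b => Phi B b x)). unfold Phi, recipF.
  auto_derive; trivial.
Qed.

(** The roots are squeezed between a test point [y] just below [xi0] and [xi0] itself. Strict
    monotonicity in [x] turns comparisons of values of [Phi] into comparisons of roots, so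
    continuity in [a] at this one [y] suffices. *)
Lemma Phi_root_lim (B K : R) (a xi : R -> R) (xi0 : R) :
  0 < B -> is_lim a p_infty 0 ->
  Rbar_locally p_infty (fun h => 0 <= a h /\ 0 < xi h /\ Phi B (a h) (xi h) = K) ->
  0 < xi0 -> Phi B 0 xi0 = K ->
  is_lim xi p_infty xi0.
Proof.
  intros HB Ha Hxi Hxi0 HK. apply is_lim_spec. intros e.
  (* The test point is within [e] of [xi0]; the bound [xi0 / 2] keeps it positive, where [Phi] is
     monotone. *)
  set (y := Rmax (xi0 / 2) (xi0 - e)).
  assert (Hy : 0 < y < xi0 /\ xi0 - e <= y).
  { pose proof (cond_pos e). unfold y, Rmax. destruct Rle_dec; lra. }
  destruct Hy as [[Hy0 Hyxi] Hye].
  assert (Hlt : Phi B 0 y < K) by (rewrite <- HK; apply Phi_incr; lra).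
  assert (Hl : is_lim (fun h => Phi B (a h) y) p_infty (Phi B 0 y)).
  { apply (is_lim_comp_continuous a (fun b => Phi B b y)); trivial.
    apply continuous_Phi_l. }
  apply is_lim_spec in Hl.
  assert (Hpos : 0 < K - Phi B 0 y) by lra.
  (* With the gap [K - Phi B 0 y] as tolerance, [Phi B (a h) y] eventually stays below [K]. *)
  specialize (Hl (mkposreal _ Hpos)). simpl pos in Hl.
  generalize (filter_and _ _ Hxi Hl). apply filter_imp.
  intros h [[Hah [Hxh HKh]] Hyh].
  assert (H1 : y < xi h).
  { apply Rnot_le_lt. intros Hle.
    assert (Phi B (a h) (xi h) <= Phi B (a h) y).
    { destruct Hle as [Hle| ->]; [apply Rlt_le, Phi_incr; lra|apply Rle_refl]. }
    apply Rabs_def2 in Hyh. lra. }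
  (* Otherwise [K = Phi B 0 xi0 <= Phi B (a h) xi0 < Phi B (a h) (xi h) = K]. *)
  assert (H2 : xi h <= xi0).
  { apply Rnot_lt_le. intros Hgt.
    pose proof (Phi_le B 0 (a h) xi0 HB (Rle_refl 0) Hah Hxi0).
    pose proof (Phi_incr B (a h) xi0 (xi h) HB Hah Hxi0 Hgt). lra. }
  pose proof (cond_pos e). apply Rabs_def1; lra.
Qed.

(** * Both problems in reduced form, with [a = robin p h0] and [a = 0] *)

Definition robin (p : constants) (h0 : R) : R := k p / (h0 * sqrt (PI * alpha p)).

Lemma alpha_gt0 (p : constants) : 0 < alpha p.
Proof.
  apply Rdiv_lt_0_compat; [apply k_gt0|].
  apply Rmult_lt_0_compat; [apply rho_gt0|apply c_gt0].
Qed.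

Lemma sqrt_PI_alpha_gt0 (p : constants) : 0 < sqrt (PI * alpha p).
Proof. apply sqrt_lt_R0, Rmult_lt_0_compat; [apply PI_RGT_0|apply alpha_gt0]. Qed.

Lemma robin_gt0 (p : constants) (h0 : R) : 0 < h0 -> 0 < robin p h0.
Proof.
  intros Hh. apply Rdiv_lt_0_compat; [apply k_gt0|].
  apply Rmult_lt_0_compat; [trivial|apply sqrt_PI_alpha_gt0].
Qed.

(** This is where the convective condition degenerates into the temperature condition: the shift of
    [erf] vanishes. *)
Lemma is_lim_robin (p : constants) : is_lim (robin p) p_infty 0.
Proof.
  pose proof (sqrt_PI_alpha_gt0 p) as HS.
  apply (is_lim_ext_loc (fun h => k p / sqrt (PI * alpha p) * / h)).
  - exists 0. intros h Hh. unfold robin. field. lra.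
  - replace (Finite 0) with (Rbar_mult (k p / sqrt (PI * alpha p)) (Rbar_inv p_infty))
      by (simpl; now rewrite Rmult_0_r).
    apply is_lim_scal_l. apply is_lim_inv; [apply is_lim_id|discriminate].
Qed.

(** Makes every admissible [h0] positive. *)
Lemma h0_threshold_ge0 (p : constants) : 0 <= h0_threshold p.
Proof.
  apply Rmult_le_pos; [|apply sqrt_pos].
  apply Rlt_le, Rdiv_lt_0_compat; [lra|apply Dinf_gt0].
Qed.

(** The coefficient [B] of [Phi], common to both problems, whose equations thus differ only in
    [a]. *)
Definition mush (p : constants) : R := gamma p * (1 - eps p) * sqrt PI / (2 * Dinf p).

Lemma mush_gt0 (p : constants) : 0 < mush p.
Proof.
  pose proof (gamma_gt0 p). pose proof (eps_lt1 p). pose proof (Dinf_gt0 p).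
  pose proof (sqrt_lt_R0 PI PI_RGT_0).
  apply Rdiv_lt_0_compat; [|lra].
  apply Rmult_lt_0_compat; trivial. apply Rmult_lt_0_compat; lra.
Qed.

Lemma F_recipF (p : constants) (h0 x : R) :
  0 < h0 -> 0 < x -> F p h0 x = / recipF (robin p h0) x.
Proof.
  intros Hh Hx. pose proof (robin_gt0 p h0 Hh). pose proof (erf_gt0 x Hx).
  unfold F, recipF. fold (robin p h0). rewrite exp_Ropp. field.
  pose proof (exp_pos (x ^ 2)). lra.
Qed.

Lemma Finf_recipF (x : R) : 0 < x -> Finf x = / recipF 0 x.
Proof.
  intros Hx. pose proof (erf_gt0 x Hx).
  unfold Finf, recipF. rewrite exp_Ropp. field.
  pose proof (exp_pos (x ^ 2)). lra.
Qed.

(** Dividing the equation by [F], whose reciprocal is [recipF], gives it the shape of the limit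
    equation. *)
Lemma is_xi_Phi (p : constants) (h0 x : R) :
  0 < h0 -> is_xi p h0 x ->
  0 < x /\ Phi (mush p) (robin p h0) x = Dinf p * c p / (ell p * sqrt PI).
Proof.
  intros Hh [[Hx He] _]. split; trivial.
  unfold G in He. fold (mush p) in He. rewrite F_recipF in He by trivial.
  pose proof (recipF_gt0 _ _ (Rlt_le _ _ (robin_gt0 p h0 Hh)) Hx).
  rewrite Rdiv_1_l, Rinv_inv in He.
  unfold Phi. rewrite <- He, Rmult_comm, Rmult_assoc, Rinv_l, Rmult_1_r; lra.
Qed.

Lemma is_xi_inf_Phi (p : constants) (x : R) :
  is_xi_inf p x ->
  0 < x /\ Phi (mush p) 0 x = Dinf p * c p / (ell p * sqrt PI).
Proof.
  intros [[Hx He] _]. split; trivial.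
  fold (mush p) in He. rewrite Finf_recipF in He by trivial.
  rewrite Rdiv_1_l, Rinv_inv in He. exact He.
Qed.

Lemma is_lim_xi (p : constants) (xi : R -> R) (xi0 : R) :
  (forall h0, h0_threshold p < h0 -> is_xi p h0 (xi h0)) -> is_xi_inf p xi0 ->
  is_lim xi p_infty xi0.
Proof.
  intros Hxi Hxi0. apply is_xi_inf_Phi in Hxi0. destruct Hxi0 as [H0 HK].
  apply (Phi_root_lim (mush p) (Dinf p * c p / (ell p * sqrt PI)) (robin p));
    trivial; [apply mush_gt0|apply is_lim_robin|].
  exists (h0_threshold p). intros h Hh.
  assert (Hh0 : 0 < h) by (pose proof (h0_threshold_ge0 p); lra).
  split; [apply Rlt_le, robin_gt0; trivial|]. apply is_xi_Phi; auto.
Qed.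

(** Since [k p / (h0 * sqrt (alpha p))] is [sqrt PI * robin p h0], it absorbs the bracket of [mu]
    into [robin p h0 + erf x]. So [mu] and [mu_inf] are one expression, taken at [a = robin p h0]
    and at [a = 0]. *)
Lemma mu_recipF (p : constants) (h0 x : R) :
  0 < h0 ->
  mu p h0 x = x + gamma p * sqrt PI / (2 * Dinf p) * recipF (robin p h0) x.
Proof.
  intros Hh. pose proof (sqrt_lt_R0 PI PI_RGT_0).
  pose proof (sqrt_lt_R0 _ (alpha_gt0 p)). pose proof (Dinf_gt0 p). pose proof (k_gt0 p).
  unfold mu, recipF, robin.
  rewrite sqrt_mult by (apply Rlt_le; apply PI_RGT_0 || apply alpha_gt0).
  field. repeat split; lra.
Qed.

Lemma mu_inf_recipF (p : constants) (x : R) :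
  mu_inf p x = x + gamma p * sqrt PI / (2 * Dinf p) * recipF 0 x.
Proof. unfold mu_inf, recipF. ring. Qed.

(** Dividing the numerator and denominator of the prefactor by [h0 * sqrt (PI * alpha p) / k p], the
    inverse of [robin p h0], confines the explicit dependence on [h0] to a factor that tends to
    1. *)
Lemma T_formula_robin (p : constants) (h0 xi x t : R) :
  0 < h0 -> 0 < xi ->
  T_formula p h0 xi x t
  = erf xi / (robin p h0 + erf xi) * Tinf_formula p xi x t.
Proof.
  intros Hh Hxi. pose proof (sqrt_PI_alpha_gt0 p) as HS. pose proof (k_gt0 p) as Hk.
  pose proof (erf_gt0 xi Hxi) as He.
  unfold T_formula, Tinf_formula, robin.
  assert (0 < h0 * sqrt (PI * alpha p) * erf xi)
    by (apply Rmult_lt_0_compat; trivial; now apply Rmult_lt_0_compat).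
  field. repeat split; try lra; nra.
Qed.

(** * Passage to the limit in the explicit formulas, all limits being finite *)

Lemma is_lim_mult_finite (f g : R -> R) (x : Rbar) (lf lg : R) :
  is_lim f x lf -> is_lim g x lg -> is_lim (fun y => f y * g y) x (lf * lg).
Proof. intros Hf Hg. now apply (is_lim_mult f g x lf lg). Qed.

Lemma is_lim_inv_finite (f : R -> R) (x : Rbar) (l : R) :
  is_lim f x l -> l <> 0 -> is_lim (fun y => / f y) x (/ l).
Proof. intros Hf Hl. apply (is_lim_inv f x l Hf). congruence. Qed.

Lemma is_lim_erf_comp (xi : R -> R) (xi0 : R) :
  is_lim xi p_infty xi0 -> is_lim (fun h => erf (xi h)) p_infty (erf xi0).
Proof. intros Hxi. apply (is_lim_comp_continuous xi erf); trivial. apply continuous_erf. Qed.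

Lemma is_lim_recipF (a xi : R -> R) (xi0 : R) :
  is_lim a p_infty 0 -> is_lim xi p_infty xi0 ->
  is_lim (fun h => recipF (a h) (xi h)) p_infty (recipF 0 xi0).
Proof.
  intros Ha Hxi.
  apply is_lim_mult_finite.
  - apply is_lim_plus'; [apply Ha|now apply is_lim_erf_comp].
  - apply (is_lim_comp_continuous xi (fun x => exp (x ^ 2))); trivial.
    apply (ex_derive_continuous (fun x => exp (x ^ 2))). auto_derive; trivial.
Qed.

Lemma is_lim_Tinf_formula (p : constants) (a xi : R -> R) (xi0 x t : R) :
  is_lim a p_infty 0 -> is_lim xi p_infty xi0 -> 0 < xi0 ->
  is_lim (fun h => erf (xi h) / (a h + erf (xi h)) * Tinf_formula p (xi h) x t)
    p_infty (Tinf_formula p xi0 x t).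
Proof.
  intros Ha Hxi H0. pose proof (erf_gt0 xi0 H0) as He.
  (* The target is written as the value of the expression at [a = 0], with a factor equal to 1, so
     that the limit rules apply term by term. *)
  replace (Tinf_formula p xi0 x t)
    with (erf xi0 * / (0 + erf xi0) * Tinf_formula p xi0 x t) by (field; lra).
  unfold Tinf_formula.
  apply is_lim_mult_finite.
  - apply is_lim_mult_finite; [now apply is_lim_erf_comp|]. apply is_lim_inv_finite; [|lra].
    apply is_lim_plus'; [apply Ha|now apply is_lim_erf_comp].
  - apply is_lim_mult_finite; [apply is_lim_const|].
    apply is_lim_minus'; [apply is_lim_const|].
    apply is_lim_mult_finite; [apply is_lim_const|].
    apply is_lim_inv_finite; [now apply is_lim_erf_comp|lra].
Qed.

Theorem theorem3 (p : constants)
  (T : R -> R -> R -> R) (s r : R -> R -> R)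
  (Tinf : R -> R -> R) (sinf rinf : R -> R)
  (HP1 : forall h0, h0_threshold p < h0 ->
     is_solution_P1 p h0 (fun x t => T x t h0) (fun t => s t h0) (fun t => r t h0))
  (Hinf : is_limit_solution p Tinf sinf rinf) :
  forall t x, 0 < t -> 0 < x < sinf t ->
    is_lim (fun h0 => T x t h0) p_infty (Tinf x t) /\
    is_lim (fun h0 => s t h0) p_infty (sinf t) /\
    is_lim (fun h0 => r t h0) p_infty (rinf t).
Proof.
  intros t x Ht Hx.
  destruct Hinf as [_ [xi0 [Hxi0 Hform0]]].
  destruct (Hform0 t Ht) as [Hs0 [Hr0 HT0]]. rewrite (HT0 x Hx), Hr0.
  (* The coefficient is read off the front at time 1, which avoids a choice of [xi]. *)
  pose (xi := fun h => s 1 h / (2 * sqrt (alpha p * 1))).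
  assert (Hsol : forall h, h0_threshold p < h -> 0 < h /\ is_xi p h (xi h) /\
    s t h = 2 * xi h * sqrt (alpha p * t) /\
    r t h = 2 * mu p h (xi h) * sqrt (alpha p * t) /\
    (0 < x < s t h -> T x t h = T_formula p h (xi h) x t)).
  { intros h Hh. destruct (HP1 h Hh) as [_ [z [Hz Hform]]].
    assert (Hxz : xi h = z).
    { destruct (Hform 1 Rlt_0_1) as [Hs1 _]. unfold xi. rewrite Hs1.
      pose proof (alpha_gt0 p).
      assert (0 < sqrt (alpha p * 1)) by (apply sqrt_lt_R0; lra). field. lra. }
    rewrite Hxz. destruct (Hform t Ht) as [Hs [Hr HT]].
    pose proof (h0_threshold_ge0 p). repeat split; trivial; [lra|apply Hz..|apply HT]. }
  assert (Hxi : is_lim xi p_infty xi0).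
  { apply (is_lim_xi p); trivial. intros h Hh. apply (Hsol h Hh). }
  (* The front comes first: its convergence also decides when [x] lies in the domain of the
     temperature formula. *)
  assert (Hs : is_lim (fun h => s t h) p_infty (sinf t)).
  { rewrite Hs0.
    apply (is_lim_ext_loc (fun h => 2 * xi h * sqrt (alpha p * t))).
    - exists (h0_threshold p). intros h Hh. symmetry. apply (Hsol h Hh).
    - apply is_lim_mult_finite; [|apply is_lim_const].
      apply is_lim_mult_finite; [apply is_lim_const|trivial]. }
  split; [|split; trivial].
  - apply (is_lim_ext_loc (fun h =>
      erf (xi h) / (robin p h + erf (xi h)) * Tinf_formula p (xi h) x t)).
    (* As [x < sinf t], the tolerance [sinf t - x] for the front yields [x < s t h] for all large
       [h], where the formula for [T] holds. *)
    + pose proof (proj2 (is_lim_spec _ _ _) Hs) as Hev.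
      assert (Hpos : 0 < sinf t - x) by lra.
      specialize (Hev (mkposreal _ Hpos)). simpl pos in Hev.
      assert (Hth : Rbar_locally p_infty (fun h => h0_threshold p < h))
        by (exists (h0_threshold p); trivial).
      generalize (filter_and _ _ Hev Hth). apply filter_imp.
      intros h [Hsh Hh]. apply Rabs_def2 in Hsh.
      destruct (Hsol h Hh) as [Hh0 [Hz [_ [_ HT]]]].
      rewrite HT by lra. symmetry. apply T_formula_robin; [trivial|apply Hz].
    + apply is_lim_Tinf_formula; trivial; [apply is_lim_robin|apply Hxi0].
  - apply (is_lim_ext_loc (fun h => 2 * (xi h
      + gamma p * sqrt PI / (2 * Dinf p) * recipF (robin p h) (xi h))
      * sqrt (alpha p * t))).
    + exists (h0_threshold p). intros h Hh.
      destruct (Hsol h Hh) as [Hh0 [_ [_ [Hr _]]]]. now rewrite Hr, mu_recipF.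
    + rewrite mu_inf_recipF.
      apply is_lim_mult_finite; [|apply is_lim_const].
      apply is_lim_mult_finite; [apply is_lim_const|].
      apply is_lim_plus'; [trivial|].
      apply is_lim_mult_finite; [apply is_lim_const|].
      apply is_lim_recipF; [apply is_lim_robin|trivial].
Qed.
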